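(* Let $n>1$ and $m$ be positive integers with $1<m<n$ and $n/m=p$, where $p$ is a prime number. Then $n$ can be expressed as the sum of $m$ primes, and for every integer $z\ge 0$, $$Y_{p(z)}(m,m\cdot p)=Y_{p(z+1)}(m+1,(m+1)\cdot p).$$
   Context: For a prime $p$ and positive integers $m$ and $z\ge 0$, let $S^{p(z)}_{m|mp}$ be the set of $m$-tuples $(p_1,\dots,p_m)$ of prime numbers with $p_1\le p_2\le\dots\le p_m$ and $\sum_{i=1}^m p_i=mp$ in which the prime $p$ occurs exactly $z$ times among $p_1,\dots,p_m$. Define $Y_{p(z)}(m,m\cdot p)$ to be the cardinality of $S^{p(z)}_{m|mp}$. *)

(* Defs.v *)
From mathcomp Require Import all_boot.

Set Implicit Arguments.
Unset Strict Implicit.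
Unset Printing Implicit Defensive.

(* The set S^{p(z)}_{m|mp}. *)
Definition prime_tuples (m p z : nat) : pred (m.-tuple nat) :=
  [pred t : m.-tuple nat |
    [&& all prime t, sorted leq t, sumn t == m * p & count_mem p t == z]].

(* Y_{p(z)}(m, m * p). Members of prime_tuples have entries at most m * p, so *)
(* they are counted over the finite type of m-tuples with entries in           *)
(* {0, ..., m * p}; by YE this is their number as tuples over nat.             *)
Definition Y (m p z : nat) : nat :=
  #|[set u : m.-tuple 'I_(m * p).+1 | prime_tuples p z (map_tuple val u)]|.

Lemma YE (m p z : nat) (s : seq (m.-tuple nat)) :
  uniq s -> s =i prime_tuples p z -> size s = Y m p z.
Proof.
move=> s_uniq sS; pose f (u : m.-tuple 'I_(m * p).+1) := map_tuple val u.
have f_inj : injective f.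
  by move=> u v /(congr1 val) /(inj_map val_inj) /val_inj.
rewrite /Y cardE -(size_map f); apply/perm_size/uniq_perm => //.
  by rewrite (map_inj_uniq f_inj) enum_uniq.
move=> t; rewrite sS; apply/idP/mapP => [St | [u]]; last first.
  by rewrite mem_enum inE => Su ->.
have t_le : {in val t, forall x, x < (m * p).+1}.
  move=> x xt; have /and4P[_ _ /eqP <- _] := St.
  by rewrite ltnS sumnE (big_rem x xt) leq_addr.
have ft : t = f (map_tuple (fun x => inord x) t).
  apply: val_inj => /=; rewrite -map_comp -[LHS]map_id.
  by apply/eq_in_map => x xt /=; rewrite inordK // t_le.
by exists (map_tuple (fun x => inord x) t); rewrite // mem_enum inE -/(f _) -ft.
Qed.

(* Main.v *)
Require Import Defs.
From mathcomp Require Import all_boot.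

(** Inserting one more [p] into a nondecreasing tuple and re-sorting is a
    bijection from S^{p(z)}_{m|mp} onto S^{p(z+1)}_{m+1|(m+1)p}, whose inverse
    removes one occurrence of [p]. *)

(** A nondecreasing tuple is a multiset. Adding one [p] raises length and multiplicity of [p] by one
    and the sum by [p], and keeps all entries prime ([insert_tuple_prime_tuples]). It can be undone,
    since multiplicity [z.+1] is positive ([insert_tuple_inj], [mem_insert_tuple]). The
    representation of [n] is [p + ... + p]. *)

(** Provides the list that [YE] takes, so that the two counts are compared over [nat] and not across
    two ordinal types. *)
Lemma bounded_tuples_enum (m b : nat) (P : pred (m.-tuple nat)) :
  (forall t, P t -> all (geq b) t) ->
  exists2 s : seq (m.-tuple nat), uniq s & s =i P.
Proof.
move=> Pb; pose f (u : m.-tuple 'I_b.+1) := map_tuple val u.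
have f_inj : injective f.
  by move=> u v /(congr1 val) /(inj_map val_inj) /val_inj.
exists (filter P (map f (enum {: m.-tuple 'I_b.+1}))).
  by rewrite filter_uniq // (map_inj_uniq f_inj) enum_uniq.
move=> t; rewrite mem_filter; have [Pt /= | Pt] := boolP (P t); last first.
  by apply/esym/negbTE.
rewrite [RHS]Pt; apply/mapP.
exists (map_tuple inord t); rewrite ?mem_enum //.
apply/val_inj; rewrite /= -map_comp -[LHS]map_id.
by apply/eq_in_map => x /(allP (Pb t Pt)) x_le /=; rewrite inordK.
Qed.

Lemma leq_sumn (s : seq nat) : all (geq (sumn s)) s.
Proof.
by apply/allP => x xs; rewrite /= sumnE (big_rem x xs) leq_addr.
Qed.

Definition insert_tuple {m : nat} (p : nat) (t : m.-tuple nat) :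
  m.+1.-tuple nat := [tuple of sort leq (p :: t)].

Lemma sorted_leq_perm (s t : seq nat) :
  sorted leq s -> sorted leq t -> perm_eq s t -> s = t.
Proof. exact: (sorted_eq leq_trans anti_leq). Qed.

Lemma insert_tuple_inj (m p : nat) :
  {in [pred t : m.-tuple nat | sorted leq t] &, injective (@insert_tuple m p)}.
Proof.
move=> t u t_sorted u_sorted /(congr1 val) /= tu.
apply/val_inj/sorted_leq_perm => //; rewrite -(perm_cons p).
by apply/(perm_sortP leq_total leq_trans anti_leq).
Qed.

(** Sorting makes the order condition automatic on the left, so none on [t] appears on the right. *)
Lemma insert_tuple_prime_tuples (m p z : nat) (t : m.-tuple nat) :
  prime p -> prime_tuples p z.+1 (insert_tuple p t) =
             [&& all prime t, sumn t == m * p & count_mem p t == z].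
Proof.
move=> p_pr; have pt : perm_eq (insert_tuple p t) (p :: t) by rewrite perm_sort.
rewrite /prime_tuples /= (sort_sorted leq_total (p :: t)) (perm_all _ pt).
rewrite (perm_sumn pt) (permP pt) /= p_pr eqxx mulSn.
by rewrite eqn_add2l add1n eqSS.
Qed.

(** Deleting one [p] leaves a sorted subsequence; reinserting it gives a sorted permutation of [t],
    hence [t]. *)
Lemma mem_insert_tuple (m p : nat) (t : m.+1.-tuple nat) :
  sorted leq t -> p \in t ->
  exists2 u : m.-tuple nat, sorted leq u & t = insert_tuple p u.
Proof.
move=> t_sorted pt.
have u_size : size (rem p t) == m by rewrite size_rem // size_tuple.
exists (Tuple u_size) => /=.
  exact: (subseq_sorted leq_trans (rem_subseq p t)) t_sorted.
apply/val_inj/sorted_leq_perm => //=; first exact: sort_sorted leq_total _.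
by rewrite perm_sym perm_sort perm_sym perm_to_rem.
Qed.

Lemma Y_insert (m p z : nat) : prime p -> Y m p z = Y m.+1 p z.+1.
Proof.
move=> p_pr.
have [|s s_uniq sS] := @bounded_tuples_enum m (m * p) (prime_tuples p z).
  by move=> t /and4P[_ _ /eqP <- _]; apply: leq_sumn.
rewrite -(@YE _ _ _ s) // -(size_map (@insert_tuple m p)).
apply: YE => [|t].
  rewrite map_inj_in_uniq // => t u; rewrite !sS => /and4P[_ t_sorted _ _].
  by move=> /and4P[_ u_sorted _ _]; apply: insert_tuple_inj.
apply/mapP/idP => [[u] | St].
  rewrite sS => /and4P[u_pr _ u_sum u_z] ->.
  by rewrite -topredE /= insert_tuple_prime_tuples // u_pr u_sum u_z.
have /and4P[_ t_sorted _ /eqP t_z] := St.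
(* The shift to [z.+1] matters here: [p] occurs at least once, even when [z = 0]. *)
have pt : p \in t by rewrite -has_pred1 has_count t_z.
have [u u_sorted tu] := mem_insert_tuple _ _ _ t_sorted pt.
have : prime_tuples p z.+1 (insert_tuple p u) by rewrite -tu.
rewrite insert_tuple_prime_tuples // => /and3P[u_pr u_sum u_z].
by exists u; rewrite // sS; apply/and4P.
Qed.

Theorem theorem3 (n m p : nat) :
  1 < n -> 0 < m -> 1 < m < n -> m %| n -> n %/ m = p -> prime p ->
  (exists t : m.-tuple nat, all prime t /\ sumn t = n) /\
  (forall z : nat, Y m p z = Y m.+1 p z.+1).
Proof.
move=> _ _ _ m_dvd n_div p_pr; split=> [|z]; last exact: Y_insert.
exists (nseq_tuple m p); rewrite all_nseq p_pr orbT sumn_nseq; split=> //.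
by rewrite -n_div divnK.
Qed.
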